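(* Let $p,d,d_2$ be positive integers. Let $\boldsymbol{C}:[-1,1]\times[0,\infty)\to\mathbb{R}^{p\times p}$ be positive definite on $\mathbb{S}^{d_2}\times\mathbb{R}^d$, with entries $C_{ij}$ such that $|C_{ij}(\cdot,\cdot)|\le1$. Let $\tau>0$ and let $[\alpha_{ij}]_{i,j=1}^p$, $[\nu_{ij}]_{i,j=1}^p$ be conditionally negative definite matrices with strictly positive entries. Then the function $\boldsymbol{K}:[-1,1]\times[-1,1]\times[0,\infty)\to\mathbb{R}^{p\times p}$ with entries $$K_{ij}(s,r,h)=\mathcal{B}(\alpha_{ij},\nu_{ij})\,\mathcal{F}\big(s\,C_{ij}(r,h);\alpha_{ij},\tau,\nu_{ij}\big)$$ is positive definite on $\mathbb{T}^{d_1,d_2}\times\mathbb{R}^d$ for all $d_1=1,2,\dots$.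
   Context: $\mathbb{S}^{n}$ is the unit sphere of $\mathbb{R}^{n+1}$; $\mathbb{T}^{d_1,d_2}=\mathbb{S}^{d_1}\times\mathbb{S}^{d_2}$; $\langle\cdot,\cdot\rangle$ is the Euclidean dot product and $\|\cdot\|$ the Euclidean norm. For a nonempty set $X$, a matrix valued function $\boldsymbol{G}:X\times X\to\mathbb{R}^{p\times p}$ satisfying $\boldsymbol{G}(x,y)=\boldsymbol{G}(y,x)^\top$ is positive definite if $\sum_{k,h=1}^N\boldsymbol{a}_k^\top\boldsymbol{G}(x_k,x_h)\boldsymbol{a}_h\ge0$ for all $N$, all $x_1,\dots,x_N\in X$ and all $\boldsymbol{a}_1,\dots,\boldsymbol{a}_N\in\mathbb{R}^p$. A function $\boldsymbol{K}(s,r,h)$ is called positive definite on $\mathbb{T}^{d_1,d_2}\times\mathbb{R}^d$ if the kernel $\big((x_1,x_2,\mathbf{u}),(x_1',x_2',\mathbf{u}')\big)\mapsto\boldsymbol{K}(\langle x_1,x_1'\rangle,\langle x_2,x_2'\rangle,\|\mathbf{u}-\mathbf{u}'\|)$ is positive definite; similarly, $\boldsymbol{C}(r,h)$ is positive definite on $\mathbb{S}^{d_2}\times\mathbb{R}^d$ if the kernel $\big((x_2,\mathbf{u}),(x_2',\mathbf{u}')\big)\mapsto\boldsymbol{C}(\langle x_2,x_2'\rangle,\|\mathbf{u}-\mathbf{u}'\|)$ is. A symmetric real matrix $[a_{ij}]_{i,j=1}^p$ is conditionally negative definite if $\sum_{i,j}c_ic_ja_{ij}\le0$ for all real $c_1,\dots,c_p$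 with $\sum_ic_i=0$. $\mathcal{B}$ denotes the Beta function. For $\alpha,\tau,\nu>0$, $$\mathcal{F}(t;\alpha,\tau,\nu)=\frac{\mathcal{B}(\alpha,\nu+\tau)}{\mathcal{B}(\alpha,\nu)}\;{}_2F_1(\tau,\alpha;\alpha+\nu+\tau;t),\qquad t\in[-1,1],$$ where ${}_2F_1$ is the Gauss hypergeometric function. *)

(* Defs.v *)
From HB Require Import structures.
From mathcomp Require Export all_boot all_order all_algebra.
From mathcomp Require Export all_classical all_reals all_analysis.
Export Order.TTheory GRing.Theory Num.Theory.
Export numFieldNormedType.Exports.

Local Open Scope classical_set_scope.
Local Open Scope ring_scope.

Section Definitions.
Context {R : realType}.

Definition dotp {n : nat} (u v : 'rV[R]_n) : R := \sum_(i < n) u 0 i * v 0 i.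

(* The library norm `|u| on row vectors is the sup norm, not this one. *)
Definition enorm {n : nat} (u : 'rV[R]_n) : R := Num.sqrt (dotp u u).

Definition sphere (n : nat) : set 'rV[R]_n.+1 := [set x | enorm x = 1].

Definition pd_kernel {T : Type} {p : nat} (X : set T) (G : T -> T -> 'M[R]_p)
    : Prop :=
  (forall x y, X x -> X y -> G x y = (G y x)^T) /\
  (forall (N : nat) (x : 'I_N -> T) (a : 'I_N -> 'cV[R]_p),
     (forall k, X (x k)) ->
     0 <= \sum_(k < N) \sum_(h < N) ((a k)^T *m G (x k) (x h) *m a h) 0 0).

(* Functions on [-1, 1] x [0, +oo[ or [-1, 1] x [-1, 1] x [0, +oo[ are taken
   total; the predicates below evaluate them only at dot products of unit
   vectors and at norms, hence only on these domains. *)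
Definition pd_sphere_space {p : nat} (d2 d : nat) (C : R -> R -> 'M[R]_p)
    : Prop :=
  pd_kernel (sphere d2 `*` [set: 'rV[R]_d])
    (fun x y => C (dotp x.1 y.1) (enorm (x.2 - y.2))).

Definition pd_torus_space {p : nat} (d1 d2 d : nat)
    (K : R -> R -> R -> 'M[R]_p) : Prop :=
  pd_kernel (sphere d1 `*` sphere d2 `*` [set: 'rV[R]_d])
    (fun x y =>
       K (dotp x.1.1 y.1.1) (dotp x.1.2 y.1.2) (enorm (x.2 - y.2))).

Definition cond_neg_def {p : nat} (A : 'M[R]_p) : Prop :=
  A^T = A /\
  forall c : 'I_p -> R, \sum_(i < p) c i = 0 ->
    \sum_(i < p) \sum_(j < p) c i * c j * A i j <= 0.

(* The library's beta_fun only takes natural number arguments. *)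
Definition Beta (a b : R) : R :=
  \int[lebesgue_measure]_(x in `[0, 1]) (x `^ (a - 1) * (1 - x) `^ (b - 1)).

Definition pochhammer (a : R) (n : nat) : R := \prod_(i < n) (a + i%:R).

(* The defining power series converges for |t| < 1, and also for |t| = 1 when
   c - a - b > 0; for the parameters used in calF below, c - a - b = nu > 0,
   so that all of [-1, 1] is covered without analytic continuation. *)
Definition hyp2F1 (a b c t : R) : R :=
  limn (series (fun n : nat =>
    pochhammer a n * pochhammer b n / pochhammer c n * (t ^+ n / n`!%:R))).

Definition calF (t alpha tau nu : R) : R :=
  Beta alpha (nu + tau) / Beta alpha nu
  * hyp2F1 tau alpha (alpha + nu + tau) t.

End Definitions.

(* Main.v *)
Require Import Defs.
From mathcomp Require Import ring lra measurable_realfun.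
Local Open Scope classical_set_scope.
Local Open Scope ring_scope.

(** The proof expands the hypergeometric function in its power series and
    recognises each coefficient as a Beta integral.  Writing t = s C_ij(r, h),
    the factors B(alpha, nu) cancel and the recursion
    B(a + 1, b) = a / (a + b) B(a, b) gives

      K_ij = sum_k (tau)_k / k! * s^k * C_ij(r, h)^k
                   * B(alpha_ij + k, nu_ij + tau)

    (cvg_Beta_calF).  For fixed k every factor is positive semidefinite: the
    scalar (tau)_k / k! is positive, s is a Gram kernel (psd_dotp), C is
    positive definite by hypothesis, and powers and products stay positive
    semidefinite by the Schur product theorem (psd_mul).  The Beta factor is
    the integral over x in ]0, 1[ of a positive weight times
    x^alpha_ij * (1 - x)^nu_ij, and by Schoenberg's theorem (cnd_psd_powR)
    x^A is positive semidefinite when A is conditionally negative definite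
    and 0 < x <= 1; integrals of positive semidefinite matrices are again
    positive semidefinite (psd_Beta).  Sums and limits preserve the property,
    which proves the theorem.

    Two analytic points need care.  The Beta integral is improper, so it is
    treated as the limit of integrals over [e, 1 - e]; the fundamental theorem
    of calculus applied to x^a (1 - x)^b there gives the recursion up to a
    boundary term, and this same identity, used in the other direction, bounds
    the truncated integrals.  And |t| = 1 does occur, so the hypergeometric
    series must be summed on the boundary of its disc of convergence, which is
    possible because c - a - b = nu > 0 (cvg_hyp2F1). *)

Set Implicit Arguments.
Unset Strict Implicit.

(** * Positive semidefinite kernels on a finite set *)

Section PositiveSemidefinite.
Context {R : realType} {I : finType}.
Implicit Types (A B : I -> I -> R) (c v : I -> R).

Definition qform A c : R := \sum_i \sum_j c i * c j * A i j.

Definition psd A : Prop :=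
  (forall i j, A i j = A j i) /\ forall c, 0 <= qform A c.

(** Moving a vector along one coordinate is the only perturbation that the
    elimination arguments below require. *)
Lemma qform_add_delta A c i (t : R) : (forall i j, A i j = A j i) ->
  qform A (fun k => c k + t * (k == i)%:R) =
  qform A c + 2 * t * \sum_k c k * A k i + t ^+ 2 * A i i.
Proof.
move=> sA.
have pick (F : I -> R) : \sum_k (k == i)%:R * F k = F i.
  by rewrite (bigD1 i) //= eqxx mul1r big1 ?addr0 // => k /negbTE ->; rewrite mul0r.
rewrite /qform.
transitivity (\sum_k ((\sum_j c k * c j * A k j + t * (c k * A k i))
    + ((k == i)%:R * (\sum_j t * (c j * A k j)) + (k == i)%:R * (t ^+ 2 * A k i)))).
  apply: eq_bigr => k _.
  have -> : t * (c k * A k i) = \sum_j (j == i)%:R * (t * (c k * A k j)).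
    by rewrite pick.
  have -> : t ^+ 2 * A k i = \sum_j (j == i)%:R * (t ^+ 2 * A k j) by rewrite pick.
  by rewrite !mulr_sumr -!big_split /=; apply: eq_bigr => j _; ring.
rewrite !big_split /= !pick -!mulr_sumr.
under [in X in _ + (t * X + _)]eq_bigr do rewrite sA.
ring.
Qed.

Lemma psd_diag_ge0 A i : psd A -> 0 <= A i i.
Proof.
case=> sA pA; have := pA (fun k => 0 + 1 * (k == i)%:R).
rewrite qform_add_delta //.
have -> : qform A (fun=> 0) = 0.
  by rewrite /qform big1 // => k _; rewrite big1 // => j _; rewrite !mul0r.
rewrite big1 => [|k _]; last by rewrite mul0r.
by rewrite mulr0 !add0r expr1n mul1r.
Qed.

(** Were A j i nonzero, moving far enough along i from the basis vector j
    would make the quadratic form, there affine in the step, negative. *)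
Lemma psd_row0 A i : psd A -> A i i = 0 -> forall j, A j i = 0.
Proof.
move=> [sA pA] Aii j; apply/eqP/negP => /negP Aji0.
(* The step is chosen to give the form the value -1. *)
have /= := pA (fun k => (k == j)%:R + (- (A j j + 1) / (2 * A j i)) * (k == i)%:R).
rewrite qform_add_delta // Aii mulr0 addr0.
have -> : \sum_k (k == j)%:R * A k i = A j i.
  by rewrite (bigD1 j) //= eqxx mul1r big1 ?addr0 // => k /negbTE ->; rewrite mul0r.
have -> : qform A (fun k => (k == j)%:R) = A j j.
  rewrite /qform (bigD1 j) //= (bigD1 j) //= eqxx !mul1r !big1 ?addr0 // => k.
    by move=> /negbTE ->; rewrite big1 // => l _; rewrite !mul0r.
  by move=> /negbTE ->; rewrite mulr0 mul0r.
suff -> : A j j + 2 * (- (A j j + 1) / (2 * A j i)) * A j i = -1 by rewrite ler0N1.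
by field.
Qed.

(** One step of Gaussian elimination: the value at c is the minimum of the
    original form along the line through c in direction i. *)
Lemma psd_schur_complement A i : psd A -> A i i != 0 ->
  psd (fun k l => A k l - A k i * A l i / A i i).
Proof.
move=> [sA pA] Aii; split=> [k l|c]; first by rewrite (sA k l); ring.
have := pA (fun k => c k + (- (\sum_k c k * A k i) / A i i) * (k == i)%:R).
rewrite qform_add_delta //; congr (_ <= _).
set m := \sum_k _.
have -> : qform A c + 2 * (- m / A i i) * m + (- m / A i i) ^+ 2 * A i i =
   qform A c - m * m / A i i by field.
rewrite /qform {1}/m !mulr_suml -sumrB; apply: eq_bigr => k _.
rewrite /m mulr_sumr mulr_suml -sumrB; apply: eq_bigr => l _; ring.
Qed.

Lemma psd_add A B : psd A -> psd B -> psd (fun i j => A i j + B i j).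
Proof.
move=> [sA pA] [sB pB]; split=> [i j|c]; first by rewrite sA sB.
have -> : qform (fun i j => A i j + B i j) c = qform A c + qform B c.
  rewrite /qform -big_split /=; apply: eq_bigr => i _.
  by rewrite -big_split /=; apply: eq_bigr => j _; rewrite mulrDr.
exact: addr_ge0.
Qed.

Lemma psd_scale A (t : R) : 0 <= t -> psd A -> psd (fun i j => t * A i j).
Proof.
move=> t0 [sA pA]; split=> [i j|c]; first by rewrite sA.
have -> : qform (fun i j => t * A i j) c = t * qform A c.
  rewrite /qform mulr_sumr; apply: eq_bigr => i _.
  by rewrite mulr_sumr; apply: eq_bigr => j _; ring.
exact: mulr_ge0.
Qed.

Lemma psd_congr A v : psd A -> psd (fun i j => v i * v j * A i j).
Proof.
move=> [sA pA]; split=> [i j|c]; first by rewrite sA (mulrC (v i)).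
have -> : qform (fun i j => v i * v j * A i j) c = qform A (fun i => c i * v i).
  by rewrite /qform; apply: eq_bigr => i _; apply: eq_bigr => j _; ring.
exact: pA.
Qed.

Lemma eq_psd A B : (forall i j, A i j = B i j) -> psd A -> psd B.
Proof.
move=> AB [sA pA]; split=> [i j|c]; first by rewrite -!AB.
suff -> : qform B c = qform A c by exact: pA.
by apply: eq_bigr => i _; apply: eq_bigr => j _; rewrite AB.
Qed.

Lemma psd_cst (t : R) : 0 <= t -> psd (fun _ _ => t).
Proof.
move=> t0; split=> // c.
have -> : qform (fun _ _ => t) c = t * (\sum_i c i) ^+ 2.
  rewrite /qform expr2 mulr_suml mulr_sumr; apply: eq_bigr => i _.
  by rewrite !mulr_sumr; apply: eq_bigr => j _; ring.
by rewrite mulr_ge0 ?sqr_ge0.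
Qed.

(** Schur product theorem.  Eliminating one index writes A as a rank one kernel
    v i * v j plus a kernel with fewer nonzero diagonal entries; the product of
    B with the former is a rescaling of B, and the induction treats the
    latter. *)
Lemma psd_mul A B : psd A -> psd B -> psd (fun i j => A i j * B i j).
Proof.
move=> pA pB; have [n] := ubnP #|[pred i | A i i != 0]|.
elim: n => // n IH in A pA *; rewrite ltnS => leAn.
case: (pickP [pred i | A i i != 0]) => [i /= Aii|A0]; last first.
  apply: (@eq_psd (fun _ _ => 0)) (psd_cst (lexx _)) => i j.
  have /negbFE/eqP Ajj := A0 j.
  by rewrite (psd_row0 pA Ajj) mul0r.
have Ai_gt0 : 0 < A i i by rewrite lt0r Aii psd_diag_ge0.
pose A' k l := A k l - A k i * A l i / A i i.
have pA' : psd A' by exact: psd_schur_complement.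
apply: (@eq_psd (fun k l => (A' k l * B k l)
    + (A i i)^-1 * (A k i * A l i * B k l))).
  by move=> k l; rewrite /A'; ring.
apply: psd_add; last by apply: psd_scale (psd_congr _ pB); rewrite invr_ge0 ltW.
apply: IH => //; apply: leq_trans leAn; apply: proper_card.
apply/properP; split; last first.
  by exists i; rewrite !inE // /A' mulfK // subrr eqxx.
apply/fintype.subsetP => k; rewrite !inE; apply: contra => /eqP Akk.
by rewrite /A' Akk (proj1 pA k i) (psd_row0 pA Akk) mul0r mul0r subr0.
Qed.

Lemma psd_exprn A n : psd A -> psd (fun i j => A i j ^+ n).
Proof.
move=> pA; elim: n => [|n IH]; first exact: psd_cst ler01.
by apply: eq_psd (psd_mul pA IH) => i j; rewrite exprS.
Qed.

Lemma psd_sum (F : nat -> I -> I -> R) n :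
  (forall k, psd (F k)) -> psd (fun i j => \sum_(0 <= k < n) F k i j).
Proof.
move=> pF; elim: n => [|n IH].
  by apply: eq_psd (psd_cst (lexx _)) => i j; rewrite big_nil.
by apply: eq_psd (psd_add IH (pF n)) => i j; rewrite big_nat_recr.
Qed.

Lemma psd_lim (F : nat -> I -> I -> R) A : (forall k, psd (F k)) ->
  (forall i j, F n i j @[n --> \oo] --> A i j) -> psd A.
Proof.
move=> pF FA; split=> [i j|c].
  apply: cvg_unique (FA i j) _ => //.
  have -> : (fun n => F n i j) = (fun n => F n j i).
    by apply/funext => n; exact: (proj1 (pF n)).
  exact: FA.
have : qform (F n) c @[n --> \oo] --> qform A c.
  apply: cvg_big => //=; first exact: add_continuous.
  move=> i _; apply: cvg_big => //=; first exact: add_continuous.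
  by move=> j _; apply: cvgMr; exact: FA.
move=> Fc; rewrite -(cvg_lim _ Fc) //; apply: limr_ge.
  by apply/cvg_ex; exists (qform A c).
by apply: nearW => n; exact: (proj2 (pF n)).
Qed.

Lemma psd_expR A : psd A -> psd (fun i j => expR (A i j)).
Proof.
move=> pA.
apply: (@psd_lim (fun n i j => series (exp_coeff (A i j)) n)) => [n|i j].
  apply: (@psd_sum (fun k i j => exp_coeff (A i j) k)) => k.
  apply: (@eq_psd (fun i j => k`!%:R^-1 * A i j ^+ k)) => [i j|].
    by rewrite exp_coeffE.
  by apply: psd_scale; [rewrite invr_ge0|exact: psd_exprn].
exact: is_cvg_series_exp_coeff.
Qed.

End PositiveSemidefinite.

(** * Pullbacks, Gram kernels and Schoenberg's theorem *)

Section SchoenbergTheory.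
Context {R : realType}.

(** The points of a kernel may repeat: coefficients attached to the same point
    add up. *)
Lemma psd_comp (I J : finType) (f : J -> I) (A : I -> I -> R) :
  psd A -> psd (fun i j => A (f i) (f j)).
Proof.
move=> [sA pA]; split=> [i j|c]; first exact: sA.
have -> : qform (fun i j => A (f i) (f j)) c
    = qform A (fun k => \sum_(i | f i == k) c i).
  rewrite /qform (partition_big f predT) //=; apply: eq_bigr => k _.
  transitivity (\sum_(i | f i == k) \sum_l \sum_(j | f j == l) c i * c j * A k l).
    apply: eq_bigr => i /eqP <-; rewrite (partition_big f predT) //=.
    by apply: eq_bigr => l _; apply: eq_bigr => j /eqP <-.
  rewrite exchange_big /=; apply: eq_bigr => l _.
  rewrite mulr_suml mulr_suml; apply: eq_bigr => i _.
  by rewrite mulr_sumr mulr_suml.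
exact: pA.
Qed.

(** Schoenberg's theorem.  Subtracting from A the terms depending on one index
    only leaves minus a kernel B that is positive semidefinite, since a vector
    c can be corrected at ord0 to have sum zero.  Then exp (- t A) is the
    entrywise exponential of t B rescaled on each side. *)
Lemma cnd_psd_expR (p : nat) (A : 'M[R]_p) (t : R) : 0 <= t ->
  cond_neg_def A -> psd (fun i j => expR (- (t * A i j))).
Proof.
move=> t0 [sA nA]; case: p => [|p] in A sA nA *.
  by split=> [[]//|c]; rewrite /qform big_ord0.
have sAE i j : A i j = A j i by rewrite -{1}sA mxE.
pose B i j := A i ord0 + A j ord0 - A ord0 ord0 - A i j.
have pB : psd B.
  split=> [i j|c]; first by rewrite /B (sAE i j); ring.
  pose s := \sum_i c i.
  pose c' i := c i + (- s) * (i == ord0)%:R.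
  have /nA : \sum_i c' i = 0.
    have S1 : \sum_(i < p.+1) (i == ord0)%:R = 1 :> R.
      by rewrite (bigD1 ord0) //= big1 ?addr0 // => i /negbTE ->.
    by rewrite /c' big_split /= -mulr_sumr S1 mulr1 -/s subrr.
  rewrite -[X in X <= 0]/(qform A c') /c' qform_add_delta //.
  have -> : qform B c = - (qform A c + 2 * - s * (\sum_k c k * A k ord0)
      + (- s) ^+ 2 * A ord0 ord0).
    transitivity (\sum_i (c i * A i ord0 * s + c i * (\sum_j c j * A j ord0)
        - c i * (s * A ord0 ord0) - \sum_j c i * c j * A i j)).
      apply: eq_bigr => i _; rewrite /s !mulr_suml !mulr_sumr -!big_split /=.
      rewrite -!sumrB; apply: eq_bigr => j _; rewrite /B; ring.
    rewrite !sumrB big_split /= -!mulr_suml -/s /qform; ring.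
  by rewrite oppr_ge0.
have /(psd_scale t0)/psd_expR := pB.
(* Half of the constant A ord0 ord0 goes to each side of the rescaling. *)
move=> /(psd_congr (fun i => expR (t * (A ord0 ord0 / 2 - A i ord0)))).
by apply: eq_psd => i j; rewrite -!expRD; congr expR; rewrite /B; field.
Qed.

Lemma cnd_psd_powR (p : nat) (A : 'M[R]_p) (x : R) : 0 < x <= 1 ->
  cond_neg_def A -> psd (fun i j => x `^ A i j).
Proof.
move=> /andP[x0 x1] nA.
have lx : 0 <= - ln x by rewrite oppr_ge0 ln_le0.
apply: eq_psd (cnd_psd_expR lx nA) => i j.
by rewrite /powR gt_eqF // mulNr opprK mulrC.
Qed.

Lemma psd_dotp (I : finType) (n : nat) (x : I -> 'rV[R]_n) :
  psd (fun i j => dotp (x i) (x j)).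
Proof.
split=> [i j|c]; first by apply: eq_bigr => k _; rewrite mulrC.
rewrite (_ : qform _ _ = \sum_k (\sum_i c i * x i 0 k) ^+ 2).
  by apply: sumr_ge0 => k _; exact: sqr_ge0.
rewrite /qform /dotp.
transitivity (\sum_i \sum_k \sum_j (c i * x i 0 k) * (c j * x j 0 k)).
  apply: eq_bigr => i _; rewrite exchange_big /=; apply: eq_bigr => j _.
  by rewrite mulr_sumr; apply: eq_bigr => k _; ring.
rewrite exchange_big /=; apply: eq_bigr => k _.
by rewrite expr2 mulr_suml; apply: eq_bigr => i _; rewrite mulr_sumr.
Qed.

(** A matrix valued kernel is positive definite exactly when its values at any
    finite family of points, indexed by pairs (point, component), form a scalar
    positive semidefinite kernel.  All later work is on such pairs. *)
Lemma pd_kernelP (T : Type) (p : nat) (X : set T) (G : T -> T -> 'M[R]_p) :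
  pd_kernel X G <-> forall (N : nat) (x : 'I_N -> T), (forall k, X (x k)) ->
    psd (fun i j : 'I_N * 'I_p => G (x i.1) (x j.1) i.2 j.2).
Proof.
have qE (N : nat) (x : 'I_N -> T) (c : 'I_N * 'I_p -> R) (a : 'I_N -> 'cV[R]_p) :
  (forall k i, a k i 0 = c (k, i)) ->
  qform (fun i j => G (x i.1) (x j.1) i.2 j.2) c =
  \sum_(k < N) \sum_(h < N) ((a k)^T *m G (x k) (x h) *m a h) 0 0.
  move=> ac; rewrite /qform.
  transitivity (\sum_k \sum_i \sum_j c (k, i) * c j * G (x k) (x j.1) i j.2).
    by rewrite [RHS]pair_bigA /=; apply: eq_bigr => -[].
  apply: eq_bigr => k _.
  transitivity (\sum_i \sum_h \sum_j c (k, i) * c (h, j) * G (x k) (x h) i j).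
    apply: eq_bigr => i _; rewrite [RHS]pair_bigA /=.
    by apply: eq_bigr => -[].
  rewrite exchange_big /=; apply: eq_bigr => h _.
  rewrite exchange_big mxE /=; apply: eq_bigr => j _.
  rewrite mxE mulr_suml; apply: eq_bigr => i _.
  by rewrite !mxE !ac; ring.
split=> [[sG pG] N x Xx|pG].
  split=> [i j|c]; first by rewrite sG // mxE.
  rewrite (qE _ _ _ (fun k => \col_i c (k, i))); first exact: pG.
  by move=> k i; rewrite mxE.
split=> [x y Xx Xy|N x a Xx].
  (* Symmetry of G at (x, y) is read off the two point family x, y. *)
  pose z (k : 'I_2) := if k == ord0 then x else y.
  have Xz k : X (z k) by rewrite /z; case: ifP.
  have [sG _] := pG _ _ Xz.
  by apply/matrixP => i j; rewrite mxE; exact: (sG (ord0, i) (ord_max, j)).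
rewrite -(qE _ _ (fun i => a i.1 i.2 0)) //.
exact: (proj2 (pG _ _ Xx)).
Qed.

End SchoenbergTheory.

(** * The Beta integral as a limit of truncated integrals *)

Section BetaIntegral.
Context {R : realType}.
Implicit Types (a b x : R) (n : nat).

Notation mu := lebesgue_measure.

Definition beta_integrand a b x : R := x `^ (a - 1) * (1 - x) `^ (b - 1).

(** The shift by 3 keeps the interval [cut n, 1 - cut n] nondegenerate. *)
Definition cut n : R := n.+3%:R^-1.

Definition trunc_beta n a b : R :=
  \int[mu]_(x in `[cut n, 1 - cut n]) beta_integrand a b x.

Lemma cut_gt0 n : 0 < cut n.
Proof. by rewrite invr_gt0. Qed.

Lemma cut_le n : cut n <= 3^-1.
Proof. by rewrite lef_pV2 ?posrE ?ltr0n // ler_nat. Qed.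

Lemma cut_itv n x : cut n <= x <= 1 - cut n -> 0 < x < 1.
Proof. by have := cut_gt0 n; lra. Qed.

Lemma cvg_cut : cut n @[n --> \oo] --> 0.
Proof.
by have := @cvg_harmonic R; rewrite -(cvg_shiftn 2); under eq_fun do rewrite addn2.
Qed.

Lemma powR_predE a x : 0 < x -> x `^ a = x * x `^ (a - 1).
Proof.
move=> x0; rewrite -[in LHS](subrK 1 a) [LHS]powRD ?(gt_eqF x0) ?implybT //.
by rewrite powRr1 ?ltW // mulrC.
Qed.

(** The derivative is written with 1 - x eliminated in favour of x, so that only
    the first exponent of the integrand changes. *)
Lemma is_derive_powR_onem a b x : 0 < x < 1 ->
  is_derive x 1 (fun y => y `^ a * (1 - y) `^ b)
    (a * beta_integrand a b x - (a + b) * beta_integrand (a + 1) b x).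
Proof.
move=> /andP[x0 x1].
have y0 : 0 < 1 - x by rewrite subr_gt0.
have d1 := is_derive1_powR a x0.
have d2 : is_derive x 1 ((@powR R ^~ b) \o (fun y => 1 - y))
    (b * (1 - x) `^ (b - 1) * (0 - 1)).
  by apply: is_derive1_comp; exact: is_derive1_powR.
apply: is_derive_eq (is_deriveM d1 d2) _.
rewrite /beta_integrand /GRing.scale /= addrK.
rewrite (powR_predE a x0) (powR_predE b y0); ring.
Qed.

Lemma derivable_beta_integrand a b x : 0 < x < 1 ->
  derivable (beta_integrand a b) x 1.
Proof. by move=> x01; have [] := is_derive_powR_onem (a - 1) (b - 1) x01. Qed.

Lemma continuous_beta_integrand n a b :
  {within `[cut n, 1 - cut n], continuous (beta_integrand a b)}.
Proof.
apply: derivable_within_continuous => x; rewrite in_itv /= => /cut_itv.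
exact: derivable_beta_integrand.
Qed.

Lemma integrable_beta_integrand n a b :
  mu.-integrable `[cut n, 1 - cut n] (EFin \o beta_integrand a b).
Proof.
apply: continuous_compact_integrable; first exact: segment_compact.
exact: continuous_beta_integrand.
Qed.

Lemma beta_integrand_ge0 a b x : 0 <= beta_integrand a b x.
Proof. by rewrite mulr_ge0 ?powR_ge0. Qed.

(** The increment of x^a (1 - x)^b over the truncated interval. *)
Definition boundary_term a b n : R :=
  (1 - cut n) `^ a * cut n `^ b - cut n `^ a * (1 - cut n) `^ b.

(** The Beta recursion in the first argument, before the cut tends to 0: on an
    interval away from 0 and 1 the fundamental theorem of calculus applies. *)
Lemma trunc_beta_recl n a b :
  a * trunc_beta n a b - (a + b) * trunc_beta n (a + 1) b = boundary_term a b n.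
Proof.
have lt_cut : cut n < 1 - cut n by have := cut_le n; lra.
have mD : measurable (`[cut n, 1 - cut n]%classic : set (measurableTypeR R)) by [].
have iB c k : mu.-integrable `[cut n, 1 - cut n] (EFin \o (fun x =>
    k * beta_integrand c b x)).
  exact: (integrableZl mD k (integrable_beta_integrand n c b)).
rewrite /trunc_beta -!RintegralZl //; try exact: integrable_beta_integrand.
rewrite -RintegralB //.
have dF x : cut n <= x <= 1 - cut n ->
    {for x, continuous (fun y => y `^ a * (1 - y) `^ b)}.
  move=> /cut_itv x01; apply: differentiable_continuous; apply/derivable1_diffP.
  by have [] := is_derive_powR_onem a b x01.
rewrite /Rintegral (continuous_FTC2 (F := fun y => y `^ a * (1 - y) `^ b)) //.
- by rewrite /boundary_term /= subKr.
- apply: derivable_within_continuous => x; rewrite in_itv /= => /cut_itv x01.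
  have dB c k : derivable (fun y => k * beta_integrand c b y) x 1.
    by apply: (derivableM (f := cst k)) => //; exact: derivable_beta_integrand.
  exact: (derivableB (dB a a) (dB (a + 1) (a + b))).
- split.
  + move=> x; rewrite in_itv /= => /andP[/ltW ? /ltW ?].
    have x01 : 0 < x < 1 by apply: (@cut_itv n); apply/andP.
    by have [] := is_derive_powR_onem a b x01.
  + by apply: cvg_at_right_filter; apply: dF; rewrite lexx ltW.
  + by apply: cvg_at_left_filter; apply: dF; rewrite lexx ltW.
- move=> x; rewrite in_itv /= => /andP[/ltW ? /ltW ?].
  have x01 : 0 < x < 1 by apply: (@cut_itv n); apply/andP.
  by have [_] := is_derive_powR_onem a b x01; rewrite derive1E.
Qed.

Lemma powR_le1 a x : 0 <= a -> 0 <= x <= 1 -> x `^ a <= 1.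
Proof.
move=> a0 /andP[x0 x1]; apply: (@le_trans _ _ (1 `^ a)); last by rewrite powR1.
by apply: ge0_ler_powR; rewrite ?nnegrE.
Qed.

Lemma cvg_powR0 (u : nat -> R) b : 0 < b -> (forall n, 0 <= u n) ->
  u n @[n --> \oo] --> 0 -> u n `^ b @[n --> \oo] --> 0.
Proof.
move=> b0 u0 cu; apply/cvgr0Pnorm_le => e e0.
(* It is enough that u n is at most the b-th root of e. *)
have eb0 : 0 < e `^ b^-1 by exact: powR_gt0.
have H : \forall n \near \oo, `|u n| <= e `^ b^-1 by exact: cvgr0_norm_le cu _ eb0.
apply: filterS H => n.
rewrite !ger0_norm ?powR_ge0 // => une.
have -> : e = (e `^ b^-1) `^ b by rewrite -powRrM mulVf ?gt_eqF // powRr1 // ltW.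
by apply: ge0_ler_powR; rewrite ?nnegrE ?powR_ge0 // ltW.
Qed.

Lemma boundary_term_bound a b n : 0 < a -> 0 < b ->
  `|boundary_term a b n| <= cut n `^ a + cut n `^ b.
Proof.
move=> a0 b0.
have c0 := cut_gt0 n; have c3 := cut_le n.
have ha : (1 - cut n) `^ a <= 1 by apply: powR_le1; [exact: ltW|lra].
have hb : (1 - cut n) `^ b <= 1 by apply: powR_le1; [exact: ltW|lra].
have h1 := powR_ge0 (1 - cut n) a; have h2 := powR_ge0 (1 - cut n) b.
have h3 := powR_ge0 (cut n) a; have h4 := powR_ge0 (cut n) b.
rewrite /boundary_term ler_norml; apply/andP; split; nra.
Qed.

Lemma boundary_term_le2 a b n : 0 < a -> 0 < b -> `|boundary_term a b n| <= 2.
Proof.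
move=> a0 b0; apply: le_trans (boundary_term_bound n a0 b0) _.
have c0 := cut_gt0 n; have c3 := cut_le n.
by rewrite (_ : 2 = 1 + 1) //; apply: lerD; apply: powR_le1; lra.
Qed.

Lemma cvg_boundary_term a b : 0 < a -> 0 < b ->
  boundary_term a b n @[n --> \oo] --> 0.
Proof.
move=> a0 b0; apply: norm_cvg0.
apply: (squeeze_cvgr (f := fun=> 0) (h := fun n => cut n `^ a + cut n `^ b)).
- by apply: nearW => n; rewrite normr_ge0 boundary_term_bound.
- exact: cvg_cst.
- rewrite -[X in _ --> X](addr0 0).
  by apply: cvgD; apply: cvg_powR0 => // [n|]; first [exact/ltW/cut_gt0|exact: cvg_cut].
Qed.

(** From x + (1 - x) = 1. *)
Lemma trunc_beta_split n a b :
  trunc_beta n a b = trunc_beta n (a + 1) b + trunc_beta n a (b + 1).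
Proof.
rewrite /trunc_beta -RintegralD //; try exact: integrable_beta_integrand.
apply: eq_Rintegral => x; rewrite inE /= in_itv /= => /cut_itv/andP[x0 x1].
have y0 : 0 < 1 - x by rewrite subr_gt0.
rewrite /beta_integrand !addrK (powR_predE a x0) (powR_predE b y0); ring.
Qed.

(** Integrability of the Beta integrand.  With both exponents raised by one the
    integrand is at most 1; the recursion lowers the first argument, and
    combined with the splitting identity it lowers the second, at the price of
    bounded boundary terms.  The bound M results from these two steps. *)
Lemma trunc_beta_bounded a b : 0 < a -> 0 < b ->
  exists M, forall n, trunc_beta n a b <= M.
Proof.
move=> a0 b0; exists (((a + b) * ((a + b + 3) / a) + 2) / b) => n.
have T1 : trunc_beta n (a + 1) (b + 1) <= 1.
  have c0 := cut_gt0 n; have c3 := cut_le n.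
  apply: (@le_trans _ _ (\int[mu]_(x in `[cut n, 1 - cut n]) (1 : R))).
    apply: le_Rintegral => //; first exact: integrable_beta_integrand.
      apply: continuous_compact_integrable; first exact: segment_compact.
      by move=> x; exact: cst_continuous.
    move=> x /=; rewrite in_itv /= => /cut_itv/andP[x0 x1].
    rewrite /beta_integrand !addrK mulr_ile1 ?powR_ge0 //.
      by apply: powR_le1; lra.
    by apply: powR_le1; lra.
  rewrite Rintegral_cst // mul1r.
  suff : fine (mu (`[cut n, 1 - cut n]%classic : set R)) <= 1 by [].
  rewrite lebesgue_measure_itv /= lte_fin.
  by case: ifP => _ //=; lra.
have := trunc_beta_recl n a (b + 1); have := trunc_beta_recl n a b.
have := trunc_beta_split n a b.
have := boundary_term_le2 n a0 b0; have : `|boundary_term a (b + 1) n| <= 2.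
  by apply: boundary_term_le2; lra.
rewrite !ler_norml => /andP[e1 e2] /andP[e3 e4] spl E1 E2.
have T2 : trunc_beta n a (b + 1) <= (a + b + 3) / a.
  rewrite ler_pdivlMr //.
  have : (a + (b + 1)) * trunc_beta n (a + 1) (b + 1) <= a + (b + 1).
    by rewrite ler_piMr //; lra.
  by lra.
rewrite ler_pdivlMr //.
have : (a + b) * trunc_beta n a (b + 1) <= (a + b) * ((a + b + 3) / a).
  by rewrite ler_pM2l //; lra.
by nra.
Qed.

Lemma bigcup_cut : \bigcup_n `[cut n, 1 - cut n]%classic = `]0, 1[%classic :> set R.
Proof.
apply/seteqP; split => x /=; first by move=> [n _] /=; rewrite !in_itv /= => /cut_itv.
rewrite in_itv /= => /andP[x0 x1].
have m0 : 0 < Num.min x (1 - x) by rewrite lt_min x0 subr_gt0.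
have [N _ HN] : \forall n \near \oo, `|cut n| <= Num.min x (1 - x).
  exact: cvgr0_norm_le cvg_cut _ m0.
exists N => //=; have /= := HN N (leqnn N).
rewrite ger0_norm; last exact: ltW (cut_gt0 N).
by rewrite le_min in_itv /= => /andP[h1 h2]; lra.
Qed.

Lemma measurable_beta_integrand a b (D : set R) :
  measurable_fun D (fun x => (beta_integrand a b x)%:E).
Proof.
apply/measurable_EFinP; apply: measurable_funS (@subsetT _ D) _ => //.
apply: measurable_funM; first exact: measurable_powR.
by apply: (measurableT_comp (measurable_powR _)); exact: measurable_funB.
Qed.

Lemma EFin_trunc_beta n a b : (trunc_beta n a b)%:E =
  (\int[mu]_(x in `[cut n, (1 - cut n)%R]%classic) (beta_integrand a b x)%:E)%E.
Proof.
rewrite /trunc_beta /Rintegral fineK //.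
by apply: integrable_fin_num => //; exact: integrable_beta_integrand.
Qed.

Lemma cut_nonincreasing n m : (n <= m)%N ->
  `[cut n, 1 - cut n]%classic `<=` (`[cut m, 1 - cut m]%classic : set R).
Proof.
move=> nm x; rewrite /= !in_itv /= => /andP[h1 h2].
have : cut m <= cut n by rewrite lef_pV2 ?posrE ?ltr0n // ler_nat !ltnS.
by lra.
Qed.

(** Monotone convergence over the increasing intervals; the uniform bound makes
    the limit finite, so that it survives the passage to real numbers in Beta. *)
Lemma cvg_trunc_beta a b : 0 < a -> 0 < b ->
  trunc_beta n a b @[n --> \oo] --> Beta a b.
Proof.
move=> a0 b0; have [M HM] := trunc_beta_bounded a0 b0.
pose D n : set R := `[cut n, 1 - cut n]%classic.
pose I : set R := `]0, 1[%classic.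
have cvgE : (\int[mu]_(x in D n) (beta_integrand a b x)%:E)%E
    @[n --> \oo] --> (\int[mu]_(x in I) (beta_integrand a b x)%:E)%E.
  rewrite /I -bigcup_cut; apply: ge0_nondecreasing_set_cvg_integral => //.
  - by move=> n m nm; rewrite subsetEset; exact: cut_nonincreasing.
  - by move=> n; rewrite /D; exact: measurable_itv.
  - by move=> n; exact: measurable_beta_integrand.
  - by move=> n x _; rewrite lee_fin beta_integrand_ge0.
have BetaE : Beta a b = fine (\int[mu]_(x in I) (beta_integrand a b x)%:E)%E.
  rewrite /Beta /Rintegral /I -integral_itv_bndo_bndc; last exact: measurable_beta_integrand.
  by rewrite -integral_itv_obnd_cbnd //; exact: measurable_beta_integrand.
have fin : (\int[mu]_(x in I) (beta_integrand a b x)%:E)%E \is a fin_num.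
  rewrite ge0_fin_numE; last by apply: integral_ge0 => x _; rewrite lee_fin beta_integrand_ge0.
  apply: le_lt_trans (ltry M); apply: cvge_to_le cvgE _.
  by apply: nearW => n; rewrite -EFin_trunc_beta lee_fin.
by rewrite BetaE; apply: fine_cvg; rewrite fineK.
Qed.

Lemma Beta_recl a b : 0 < a -> 0 < b -> Beta (a + 1) b = a / (a + b) * Beta a b.
Proof.
move=> a0 b0.
have ab0 : a + b != 0 by rewrite gt_eqF // addr_gt0.
have a10 : 0 < a + 1 by rewrite addr_gt0.
have L : a * trunc_beta n a b - (a + b) * trunc_beta n (a + 1) b @[n --> \oo]
    --> a * Beta a b - (a + b) * Beta (a + 1) b.
  by apply: cvgB; apply: cvgMr; exact: cvg_trunc_beta.
have E : a * Beta a b - (a + b) * Beta (a + 1) b = 0.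
  move: L; under eq_fun do rewrite trunc_beta_recl.
  by move=> L; apply: cvg_unique L (cvg_boundary_term a0 b0).
move: E => /subr0_eq E; apply: (mulfI ab0); rewrite -E; field.
exact: ab0.
Qed.

(** The truncated integrals increase and the first one, over [1/3, 2/3], is
    bounded below by a positive constant. *)
Lemma Beta_gt0 a b : 0 < a -> 0 < b -> 0 < Beta a b.
Proof.
move=> a0 b0.
pose m : R := 3^-1 `^ `|a - 1| * 3^-1 `^ `|b - 1|.
have m0 : 0 < m by rewrite mulr_gt0 // powR_gt0 // invr_gt0.
(* Valid for either sign of the exponent. *)
have low c x : 3^-1 <= x <= 1 -> 3^-1 `^ `|c| <= x `^ c.
  move=> /andP[x3 x1]; have x0 : 0 < x by lra.
  apply: (@le_trans _ _ (x `^ `|c|)).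
    by apply: ge0_ler_powR; rewrite ?nnegrE ?invr_ge0 // ltW.
  by apply: ger_powR; [rewrite x0|exact: ler_norm].
have T0 : m * 3^-1 <= trunc_beta 0 a b.
  have <- : \int[mu]_(x in `[cut 0, 1 - cut 0]) m = m * 3^-1.
    rewrite Rintegral_cst //; congr (_ * _).
    suff : fine (mu (`[cut 0, 1 - cut 0]%classic : set R)) = 3^-1 by [].
    rewrite lebesgue_measure_itv /= lte_fin /cut.
    by case: ifP => /=; lra.
  apply: le_Rintegral => //; last 2 first.
  - exact: integrable_beta_integrand.
  - move=> x /=; rewrite in_itv /= /cut => xc.
    by apply: ler_pM; rewrite ?powR_ge0 //; apply: low; lra.
  - apply: continuous_compact_integrable; first exact: segment_compact.
    by move=> x; exact: cst_continuous.
apply: lt_le_trans (_ : m * 3^-1 <= _); first by rewrite mulr_gt0 // invr_gt0.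
rewrite -(cvg_lim _ (cvg_trunc_beta a0 b0)) //; apply: limr_ge.
  by apply/cvg_ex; exists (Beta a b); exact: cvg_trunc_beta.
apply: nearW => n; apply: le_trans T0 _.
rewrite -lee_fin !EFin_trunc_beta; apply: ge0_subset_integral => //.
- exact: measurable_beta_integrand.
- by move=> x _; rewrite lee_fin beta_integrand_ge0.
- exact: cut_nonincreasing.
Qed.

Lemma Beta_addn a b n : 0 < a -> 0 < b ->
  Beta (a + n%:R) b = Beta a b * pochhammer a n / pochhammer (a + b) n.
Proof.
move=> a0 b0; elim: n => [|n IH].
  by rewrite /pochhammer !big_ord0 addr0 mulr1 divr1.
rewrite -natr1 addrA Beta_recl ?ltr_wpDr // IH /pochhammer !big_ord_recr /=.
have -> : a + n%:R + b = a + b + n%:R by rewrite addrAC.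
by rewrite invfM; ring.
Qed.

End BetaIntegral.

(** * Integrals of positive semidefinite kernels *)

Section MixtureIntegral.
Context {R : realType} {d : measure_display} {T : measurableType d}.
Context (mu : {measure set T -> \bar R}).

Lemma integrable_Rsum (I : Type) (s : seq I) (D : set T) (f : I -> T -> R) :
  measurable D -> (forall i, mu.-integrable D (EFin \o f i)) ->
  mu.-integrable D (EFin \o (fun x => \sum_(i <- s) f i x)).
Proof.
move=> mD fi.
have := integrable_sum mD s (P := predT) (fun i _ => fi i).
by apply: eq_integrable => // x _; rewrite /= sumEFin.
Qed.

Lemma Rintegral_sum (I : Type) (s : seq I) (D : set T) (f : I -> T -> R) :
  measurable D -> (forall i, mu.-integrable D (EFin \o f i)) ->
  \int[mu]_(x in D) (\sum_(i <- s) f i x) =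
  \sum_(i <- s) \int[mu]_(x in D) f i x.
Proof.
move=> mD fi; elim: s => [|i s IH].
  rewrite big_nil; under eq_Rintegral do rewrite big_nil.
  by rewrite Rintegral_cst // mul0r.
rewrite big_cons -IH -RintegralD //; last exact: integrable_Rsum.
by apply: eq_Rintegral => x _; rewrite big_cons.
Qed.

Lemma psd_Rintegral (I : finType) (D : set T) (F : T -> I -> I -> R) :
  measurable D ->
  (forall i j, mu.-integrable D (fun x => (F x i j)%:E)) ->
  (forall x, D x -> psd (F x)) ->
  psd (fun i j => \int[mu]_(x in D) F x i j).
Proof.
move=> mD iF pF; split=> [i j|c].
  by apply: eq_Rintegral => x /set_mem Dx; exact: (proj1 (pF x Dx)).
have ic k i j : mu.-integrable D (EFin \o (fun x => k * F x i j)).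
  exact: (integrableZl mD k (iF i j)).
have -> : qform (fun i j => \int[mu]_(x in D) F x i j) c
    = \int[mu]_(x in D) qform (F x) c.
  rewrite /qform Rintegral_sum // => [|i]; last exact: integrable_Rsum.
  apply: eq_bigr => i _; rewrite Rintegral_sum //.
  by apply: eq_bigr => j _; rewrite RintegralZl //; exact: iF.
by apply: Rintegral_ge0 => x Dx; exact: (proj2 (pF x Dx)).
Qed.

End MixtureIntegral.

(** The Beta integrand at x is a positive weight times x^alpha (1 - x)^nu, a Schur
    product of two Schoenberg kernels.  The truncated integrals inherit
    positive semidefiniteness, and so does their limit. *)
Lemma psd_Beta {R : realType} (p : nat) (alpha nu : 'M[R]_p) (a b : R) :
  cond_neg_def alpha -> cond_neg_def nu ->
  (forall i j, 0 < alpha i j) -> (forall i j, 0 < nu i j) ->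
  0 <= a -> 0 <= b ->
  psd (fun i j => Beta (alpha i j + a) (nu i j + b)).
Proof.
move=> ca cn alpha0 nu0 a0 b0.
apply: (@psd_lim _ _ (fun n i j => trunc_beta n (alpha i j + a) (nu i j + b))) => [n|i j].
  apply: psd_Rintegral => // [i j|x].
    exact: integrable_beta_integrand.
  rewrite /= in_itv /= => /cut_itv/andP[x0 x1].
  have y0 : 0 < 1 - x by rewrite subr_gt0.
  apply: (@eq_psd _ _ (fun i j => x `^ (a - 1) * (1 - x) `^ (b - 1)
      * (x `^ alpha i j * (1 - x) `^ nu i j))) => [i j|].
    have split z r e : 0 < z -> z `^ (r + e - 1) = z `^ r * z `^ (e - 1).
      by move=> z0; rewrite -addrA powRD ?(gt_eqF z0) ?implybT.
    by rewrite /beta_integrand !split //; ring.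
  apply: psd_scale; first by rewrite mulr_ge0 ?powR_ge0.
  by apply: psd_mul; apply: cnd_psd_powR => //; lra.
by apply: cvg_trunc_beta; rewrite ltr_wpDr.
Qed.

(** * The hypergeometric series on the closed disc *)

Section Hypergeometric.
Context {R : realType}.
Implicit Types a b c t : R.

Lemma pochhammerS a n : pochhammer a n.+1 = pochhammer a n * (a + n%:R).
Proof. by rewrite /pochhammer big_ord_recr. Qed.

Lemma pochhammer_gt0 a n : 0 < a -> 0 < pochhammer a n.
Proof. by move=> a0; apply: prodr_gt0 => i _; rewrite ltr_wpDr. Qed.

(** Raabe's test.  The coefficients U satisfy
    n U n - (n + 1) U (n + 1) = U n (n s - a b) / (c + n) with s = c - a - b > 0,
    so that eventually U n is at most 2 / s times this difference, and the
    partial sums telescope. *)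
Lemma cvg_hyp2F1_at1 a b c : 0 < a -> 0 < b -> a + b < c ->
  cvgn (series (fun n => pochhammer a n * pochhammer b n / pochhammer c n / n`!%:R)).
Proof.
move=> a0 b0 abc; set U := fun n => _; set s := c - a - b.
have s0 : 0 < s by rewrite /s; lra.
have c0 : 0 < c by lra.
have U0 n : 0 < U n.
  by rewrite /U !divr_gt0 ?mulr_gt0 ?pochhammer_gt0 ?ltr0n ?fact_gt0.
have US n : (c + n%:R) * (n.+1%:R * U n.+1) = (a + n%:R) * (b + n%:R) * U n.
  have cn0 : c + n%:R != 0 by rewrite gt_eqF // ltr_wpDr.
  have pn0 : pochhammer c n != 0 by rewrite gt_eqF // pochhammer_gt0.
  have fn0 : n`!%:R != 0 :> R by rewrite pnatr_eq0 -lt0n fact_gt0.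
  have n0 : n.+1%:R != 0 :> R by rewrite pnatr_eq0.
  rewrite /U !pochhammerS factS natrM; field.
  by rewrite cn0 pn0 fn0 nat1r n0.
(* For n >= N one has (n s - a b) / (c + n) >= s / 2. *)
pose N := Num.bound ((2 * a * b + s * c) / s).
have step n : (N <= n)%N -> U n <= 2 / s * (n%:R * U n - n.+1%:R * U n.+1).
  move=> Nn.
  have ns : 2 * a * b + s * c <= s * n%:R.
    rewrite [leRHS]mulrC -ler_pdivrMr //; apply: (@le_trans _ _ N%:R).
      apply/ltW/archi_boundP; rewrite divr_ge0 ?ltW //.
      by rewrite addr_gt0 ?mulr_gt0.
    by rewrite ler_nat.
  have cn0 : 0 < c + n%:R by rewrite ltr_wpDr.
  have -> : n.+1%:R * U n.+1 = (a + n%:R) * (b + n%:R) * U n / (c + n%:R).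
    by rewrite -US mulrAC divff ?mul1r ?gt_eqF.
  rewrite -subr_ge0.
  have -> : 2 / s * (n%:R * U n - (a + n%:R) * (b + n%:R) * U n / (c + n%:R)) - U n
      = U n * (s * n%:R - (2 * a * b + s * c)) / (s * (c + n%:R)).
    by rewrite /s; field; rewrite !gt_eqF.
  apply: divr_ge0; apply: mulr_ge0; try exact: ltW.
  by rewrite subr_ge0.
have tail n : series U (N + n)%N + 2 / s * ((N + n)%:R * U (N + n)%N) <=
    series U N + 2 / s * (N%:R * U N).
  elim: n => [|n IH]; first by rewrite addn0.
  apply: le_trans _ IH; rewrite addnS seriesSr.
  by rewrite -addrA lerD2l -lerBrDr -mulrBr; exact: step (leq_addr n N).
have Und : {homo series U : n m / (n <= m)%N >-> n <= m}.
  by apply: nondecreasing_series => n _ _; exact: ltW.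
apply: nondecreasing_is_cvgn => //.
exists (series U N + 2 / s * (N%:R * U N)) => _ [n _ <-].
apply: le_trans (Und _ _ (leq_addl N n)) _; apply: le_trans (tail n).
by rewrite lerDl; apply: mulr_ge0; [apply: divr_ge0|apply: mulr_ge0] => //; exact: ltW.
Qed.

Lemma cvg_hyp2F1 a b c t : 0 < a -> 0 < b -> a + b < c -> `|t| <= 1 ->
  cvgn (series (fun n => pochhammer a n * pochhammer b n / pochhammer c n
    * (t ^+ n / n`!%:R))).
Proof.
move=> a0 b0 abc t1; apply: normed_cvg.
apply: series_le_cvg (cvg_hyp2F1_at1 a0 b0 abc) => n.
- exact: normr_ge0.
- by rewrite !mulr_ge0 ?invr_ge0 ?ltW ?pochhammer_gt0 //; lra.
- have c0 : 0 < c by lra.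
  have p0 : 0 < pochhammer a n * pochhammer b n / pochhammer c n.
    by rewrite divr_gt0 ?mulr_gt0 ?pochhammer_gt0.
  rewrite /= normrM (gtr0_norm p0) ler_pM2l // normrM normfV normr_nat.
  by rewrite ler_piMl ?invr_ge0 // normrX exprn_ile1.
Qed.

(** The denominators of the Pochhammer symbols are absorbed by the Beta
    function: B(alpha, nu + tau) (alpha)_k / (alpha + nu + tau)_k
    = B(alpha + k, nu + tau). *)
Lemma cvg_Beta_calF (alpha tau nu t : R) :
  0 < alpha -> 0 < tau -> 0 < nu -> `|t| <= 1 ->
  series (fun k => pochhammer tau k / k`!%:R * t ^+ k
     * Beta (alpha + k%:R) (nu + tau)) n @[n --> \oo] -->
  Beta alpha nu * calF t alpha tau nu.
Proof.
move=> alpha0 tau0 nu0 t1.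
have nt0 : 0 < nu + tau by rewrite addr_gt0.
rewrite /calF mulrA mulrCA divff ?gt_eqF ?Beta_gt0 // mulr1.
have cv : tau + alpha < alpha + nu + tau by lra.
have L : Beta alpha (nu + tau) * series (fun n => pochhammer tau n
    * pochhammer alpha n / pochhammer (alpha + nu + tau) n * (t ^+ n / n`!%:R)) n
    @[n --> \oo] --> Beta alpha (nu + tau) * hyp2F1 tau alpha (alpha + nu + tau) t.
  by apply: cvgMr; exact: cvg_hyp2F1.
apply: cvg_trans L; apply: near_eq_cvg; apply: nearW => n.
rewrite /series /= mulr_sumr; apply: eq_bigr => k _.
by rewrite Beta_addn // addrA; ring.
Qed.

End Hypergeometric.

(** * Assembling the kernel *)

Section Sphere.
Context {R : realType}.

Lemma sphere_dotp1 (n : nat) (x : 'rV[R]_n.+1) : sphere n x -> dotp x x = 1.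
Proof.
rewrite /sphere /= /enorm => x1.
have x0 : 0 <= dotp x x by apply: sumr_ge0 => i _; rewrite -expr2 sqr_ge0.
by rewrite -(sqr_sqrtr x0) x1 expr1n.
Qed.

(** Cauchy-Schwarz for unit vectors, from the squared norms of x + y and
    x - y. *)
Lemma sphere_dotp_le1 (n : nat) (x y : 'rV[R]_n.+1) :
  sphere n x -> sphere n y -> `|dotp x y| <= 1.
Proof.
move=> /sphere_dotp1 xx /sphere_dotp1 yy.
have H (e : R) : 0 <= dotp x x + 2 * e * dotp x y + e ^+ 2 * dotp y y.
  rewrite /dotp !mulr_sumr -!big_split; apply: sumr_ge0 => i _ /=.
  have -> : x 0 i * x 0 i + 2 * e * (x 0 i * y 0 i) + e ^+ 2 * (y 0 i * y 0 i)
    = (x 0 i + e * y 0 i) ^+ 2 by ring.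
  exact: sqr_ge0.
have := H 1; have := H (-1); rewrite xx yy ler_norml => h1 h2.
by apply/andP; split; lra.
Qed.

End Sphere.

Unset Implicit Arguments.

Theorem proposition3p4 (R : realType) (p d d2 : nat)
    (p_gt0 : (0 < p)%N) (d_gt0 : (0 < d)%N) (d2_gt0 : (0 < d2)%N)
    (C : R -> R -> 'M[R]_p)
    (C_pd : pd_sphere_space d2 d C)
    (C_le1 : forall (r h : R) (i j : 'I_p),
        -1 <= r <= 1 -> 0 <= h -> `|C r h i j| <= 1)
    (tau : R) (tau_gt0 : 0 < tau)
    (alpha nu : 'M[R]_p)
    (alpha_cnd : cond_neg_def alpha) (nu_cnd : cond_neg_def nu)
    (alpha_gt0 : forall i j : 'I_p, 0 < alpha i j)
    (nu_gt0 : forall i j : 'I_p, 0 < nu i j) :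
  forall d1 : nat, (0 < d1)%N ->
    pd_torus_space d1 d2 d (fun s r h : R =>
      \matrix_(i < p, j < p)
        (Beta (alpha i j) (nu i j)
         * calF (s * C r h i j) (alpha i j) tau (nu i j))).
Proof.
move=> d1 _; apply/pd_kernelP => N x Xx.
pose s (k h : 'I_N) := dotp (x k).1.1 (x h).1.1.
pose c (i j : 'I_N * 'I_p) := C (dotp (x i.1).1.2 (x j.1).1.2)
  (enorm ((x i.1).2 - (x j.1).2)) i.2 j.2.
have pc : psd c.
  move/pd_kernelP: C_pd => /(_ N (fun k => ((x k).1.2, (x k).2))); apply=> k.
  by case: (Xx k) => -[].
have ps : psd (fun i j : 'I_N * 'I_p => s i.1 j.1).
  exact: (psd_dotp (fun i : 'I_N * 'I_p => (x i.1).1.1)).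
have sc_le1 i j : `|s i.1 j.1 * c i j| <= 1.
  have [[xi1 xi2] _] := Xx i.1; have [[xj1 xj2] _] := Xx j.1.
  rewrite normrM mulr_ile1 ?normr_ge0 //; first exact: sphere_dotp_le1.
  by apply: C_le1; [rewrite -ler_norml; exact: sphere_dotp_le1|exact: sqrtr_ge0].
apply: (@psd_lim _ _ (fun n i j => series (fun k =>
   pochhammer tau k / k`!%:R * (s i.1 j.1 * c i j) ^+ k
     * Beta (alpha i.2 j.2 + k%:R) (nu i.2 j.2 + tau)) n)) => [n|i j]; last first.
  by rewrite mxE; exact: cvg_Beta_calF.
apply: psd_sum => k.
apply: psd_mul; last first.
  apply: (psd_comp snd (psd_Beta alpha_cnd nu_cnd alpha_gt0 nu_gt0 _ _)) => //.
  exact: ltW.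
apply: psd_scale; first by rewrite divr_ge0 // ltW // pochhammer_gt0.
exact: psd_exprn (psd_mul ps pc).
Qed.
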